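(* The group $\mathrm{Aut}_{\sigma_k}$ is isomorphic to $\mathbb{Z}_k$. In particular, $\sigma_k$ is never regular.
   Context: Points of $\mathbb{C}^4$ are written $z=(z_0,\underline{z})$ with $\underline{z}=(z_1,z_2,z_3)$, and $\underline{z}^2:=z_1^2+z_2^2+z_3^2\in\mathbb{C}$. For a positive integer $k$, the polynomials $p_0^k$ and $p_1^{k-1}$ in two variables are determined by $(x+\imath y)^k=p_0^k(x,y^2)+\imath\, y\,p_1^{k-1}(x,y^2)$ for $x,y\in\mathbb{R}$, and $\sigma_k$ is $$\sigma_k(z_0,\underline{z})=\big(p_0^k(z_0,\underline{z}^2),\ p_1^{k-1}(z_0,\underline{z}^2)\,\underline{z}\big).$$ Put $$\Omega=\{(z_0,\underline{z})\in\mathbb{C}^4:\ \underline{z}^2\ne0,\ z_0^2+\underline{z}^2\neq0,\ z_0\neq0\},\qquad \Omega_k=\{(z_0,\underline{z})\in\Omega:\ p_1^{k-1}(z_0,\underline{z}^2)\neq0\}.$$ The map $\sigma_k$ is considered as a covering map $\sigma_k:\Omega_k\to\Omega$ of degree $k^2$. For a covering map $\pi:X\to Y$, $\mathrm{Aut}_\pi$ denotes the group of automorphisms $f$ of $X$ such that $\pi\circ f=\pi$; the covering is regular (or normal, or Galois) if this group acts transitively on the fibres.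
   Formalization: ''Never regular'' is proved for k ≥ 2, since σ_1 is the identity of Ω and hence regular; as σ_k does not map all of Ω_k into Ω for k ≥ 2, both claims are proved for the total space Ω_k and also for Ω_k ∩ σ_k^{-1}(Ω). *)

(* Defs.v *)
From HB Require Import structures.
From mathcomp Require Import all_boot all_order all_algebra.
From mathcomp Require Import all_classical all_reals all_analysis.
From mathcomp Require Import complex.

Set Implicit Arguments.
Unset Strict Implicit.
Unset Printing Implicit Defensive.

Import Order.TTheory GRing.Theory Num.Theory.
Import numFieldNormedType.Exports.

Local Open Scope classical_set_scope.
Local Open Scope ring_scope.

(* The usual topology and norm on the complex numbers. *)
HB.instance Definition _ (R : rcfType) := NormedModule.copy R[i] R[i]^o.

Definition C4 (R : realType) : topologicalType := (R[i] * 'rV[R[i]]_3)%type.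

(* These are obtained by expanding (x + iy)^k and writing t for y^2: p0 k is
   p_0^k, and p1 k is p_1^{k-1} (the superscript being the degree in x, y);
   cf. p01E. *)
Definition p0 (A : comNzRingType) (k : nat) (x t : A) : A :=
  \sum_(j < k.+1 | ~~ odd j) (x ^+ (k - j) * (- t) ^+ j./2) *+ 'C(k, j).

Definition p1 (A : comNzRingType) (k : nat) (x t : A) : A :=
  \sum_(j < k.+1 | odd j) (x ^+ (k - j) * (- t) ^+ j./2) *+ 'C(k, j).

Lemma p01E (R : realType) (k : nat) (x y : R) :
  (x%:C + 'i * y%:C)%C ^+ k =
  ((p0 k x (y ^+ 2))%:C + 'i * y%:C * (p1 k x (y ^+ 2))%:C)%C.
Proof.
have aux (j : nat) (z : R[i]) :
    ('i%C * z) ^+ j = ('i%C * z) ^+ odd j * (- z ^+ 2) ^+ j./2.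
  rewrite -[in LHS](odd_double_half j) exprD -mul2n exprM.
  by rewrite [('i%C * z) ^+ 2]exprMn sqr_i mulN1r.
rewrite exprDn (bigID (fun j : 'I_k.+1 => ~~ odd j)) /=; congr (_ + _).
  rewrite /p0 rmorph_sum; apply: eq_bigr => j /negbTE oj.
  by rewrite aux oj expr0 mul1r rmorphMn rmorphM rmorphXn rmorphXn rmorphN
    rmorphXn.
rewrite /p1 rmorph_sum mulr_sumr; apply: eq_big => j; first by rewrite negbK.
rewrite negbK => oj.
rewrite aux oj expr1 rmorphMn rmorphM rmorphXn rmorphXn rmorphN rmorphXn.
by rewrite mulrnAr mulrCA.
Qed.

Section Sigma.
Context {R : realType}.
Implicit Types (k : nat) (z : C4 R).

(* The square of the vector part is bilinear, not Hermitian. *)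
Definition vsq (v : 'rV[R[i]]_3) : R[i] := \sum_(i < 3) v 0 i ^+ 2.

Definition sigma k z : C4 R :=
  (p0 k z.1 (vsq z.2), p1 k z.1 (vsq z.2) *: z.2).

Definition Omega : set (C4 R) :=
  [set z | [/\ vsq z.2 != 0, z.1 ^+ 2 + vsq z.2 != 0 & z.1 != 0]].

Definition Omega_k k : set (C4 R) :=
  Omega `&` [set z | p1 k z.1 (vsq z.2) != 0].

(* For k >= 2, sigma k does not map all of Omega_k into Omega: if k = 2 and
   z_0^2 = vsq z_, the first coordinate of the image vanishes. This is the part
   of Omega_k lying over Omega; it is the whole preimage of Omega. *)
Definition Omega_k_over k : set (C4 R) := Omega_k k `&` sigma k @^-1` Omega.

Definition sigma_on k (X : set (C4 R)) (x : X) : C4 R := sigma k (val x).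

End Sigma.

Arguments sigma_on {R} k X x.

Section Deck.
Context {X : topologicalType} {Y : Type} (pi : X -> Y).

Definition homeomorphism (f : X -> X) : Prop :=
  exists g : X -> X,
    [/\ cancel f g, cancel g f, continuous f & continuous g].

Definition is_deck (f : X -> X) : Prop := homeomorphism f /\ pi \o f = pi.

(* Aut_pi; its product is composition, (f * g) x = f (g x). *)
Definition deck_group : Type := [set f | is_deck f].

HB.instance Definition _ := Choice.on deck_group.

Definition aut_fun (f : deck_group) : X -> X := val f.

Lemma aut_funP (f : deck_group) : is_deck (aut_fun f).
Proof. exact: (set_valP f). Qed.

Definition mk_aut (f : X -> X) (hf : is_deck f) : deck_group :=
  exist _ f (mem_set hf).

Lemma aut_inj (f g : deck_group) : aut_fun f =1 aut_fun g -> f = g.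
Proof. by move=> fg; apply: val_inj; apply/funext => x; exact: fg. Qed.

Lemma is_deck_id : is_deck id.
Proof. by split=> //; exists id; split=> // x; exact: cvg_id. Qed.

Lemma is_deck_comp (f g : X -> X) :
  is_deck f -> is_deck g -> is_deck (f \o g).
Proof.
move=> [[f' [fK f'K cf cf']] pf] [[g' [gK g'K cg cg']] pg]; split.
  exists (g' \o f'); split; [exact: can_comp|exact: can_comp| |].
    by move=> x; apply: continuous_comp; [exact: cg|exact: cf].
  by move=> x; apply: continuous_comp; [exact: cf'|exact: cg'].
by rewrite compA pf pg.
Qed.

Lemma is_deck_inv (f : X -> X) :
  is_deck f -> exists g, [/\ is_deck g, cancel f g & cancel g f].
Proof.
move=> [[g [fK gK cf cg]] pf]; exists g; split=> //; split.
  by exists f; split.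
by apply/funext => x /=; rewrite -[in LHS]pf /= gK.
Qed.

Definition aut_one : deck_group := mk_aut is_deck_id.

Definition aut_mul (f g : deck_group) : deck_group :=
  mk_aut (is_deck_comp (aut_funP f) (aut_funP g)).

Definition aut_inv (f : deck_group) : deck_group :=
  let: exist _ h := cid (is_deck_inv (aut_funP f)) in
  let: And3 dg _ _ := h in mk_aut dg.

Lemma aut_invK (f : deck_group) :
  cancel (aut_fun f) (aut_fun (aut_inv f)) /\
  cancel (aut_fun (aut_inv f)) (aut_fun f).
Proof. by rewrite /aut_inv; case: cid => g [dg fK gK]. Qed.

Lemma aut_mulA : associative aut_mul.
Proof. by move=> f g h; apply: aut_inj. Qed.

Lemma aut_mul1 : left_id aut_one aut_mul.
Proof. by move=> f; apply: aut_inj. Qed.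

Lemma aut_1mul : right_id aut_one aut_mul.
Proof. by move=> f; apply: aut_inj. Qed.

Lemma aut_mulV : left_inverse aut_one aut_inv aut_mul.
Proof. by move=> f; apply: aut_inj => x /=; exact: (aut_invK f).1. Qed.

Lemma aut_Vmul : right_inverse aut_one aut_inv aut_mul.
Proof. by move=> f; apply: aut_inj => x /=; exact: (aut_invK f).2. Qed.

HB.instance Definition _ :=
  isGroup.Build deck_group aut_mulA aut_mul1 aut_1mul aut_mulV aut_Vmul.

Definition regular_over (B : set Y) : Prop :=
  forall y, B y -> forall x x' : X, pi x = y -> pi x' = y ->
  exists f : deck_group, aut_fun f x = x'.

End Deck.

Definition group_isomorphic (G H : groupType) : Prop :=
  exists phi : G -> H, bijective phi /\ {morph phi : f g / (f * g)%g}.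

(* The integers modulo k, for 0 < k, as the additive group of 'I_k; not 'Z_k,
   because 'Z_1 has two elements. *)
Definition Zmodulo (k : nat) : groupType := 'I_k.-1.+1.

(* Main.v *)
Require Import Defs.
From mathcomp Require Import all_boot all_order all_algebra.
From mathcomp Require Import all_classical all_reals all_analysis.
From mathcomp Require Import cyclic separable cyclotomic complex ring zify.

Set Implicit Arguments.
Unset Strict Implicit.
Unset Printing Implicit Defensive.

Import Order.TTheory GRing.Theory Num.Theory.
Import numFieldNormedType.Exports.

Local Open Scope classical_set_scope.
Local Open Scope ring_scope.

(** As [sigma k] is homogeneous of degree [k], multiplication by a [k]-th root
    of unity is a deck transformation. Conversely, every deck
    transformation is of this kind, because the domain has a connected double
    covering on which [sigma k] is a power map. Its points are the pairs [(z, y)]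
    with [y^2 = vsq z_]. In the coordinates [z_0 + i y] and [z_0 - i y], the map
    [sigma k] raises to the [k]-th power ([expr_p01]); so a deck transformation
    multiplies each of the two by a [k]-th root of unity, which is constant by
    continuity and connectedness. The exchange of [y] and [- y] swaps the two
    coordinates and fixes [z], so the two roots of unity are equal, and the
    transformation is scalar ([deck_scalar]).

    Connectedness ([lifted_path]) holds because the pairs [(z, y)] are the image,
    under polynomials, of the complement of a hypersurface in a complex vector
    space. Two points of such a complement lie on a complex line that meets the
    hypersurface in finitely many points, and infinitely many arcs of this line, disjoint
    except at their ends, join them ([arc_avoids]).

    The scalars form a cyclic group of order [k]. It cannot act transitively on a
    fibre if [k > 1], since a root of unity can be applied to one of the two
    coordinates without changing the image; [fibre_pt] is such a family of
    points. *)

(** * The polynomials p0 and p1 over a commutative ring *)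

(** The defining identity of [p0] and [p1] is formal: it needs only a square
    root of -1 in the ring, so that it applies to complex [x] and [y] too. *)
Lemma expr_p01 (A : comNzRingType) (i : A) (k : nat) (x y : A) :
  i ^+ 2 = -1 ->
  (x + i * y) ^+ k = p0 k x (y ^+ 2) + i * y * p1 k x (y ^+ 2).
Proof.
move=> i2.
have aux (j : nat) :
    (i * y) ^+ j = (i * y) ^+ odd j * (- y ^+ 2) ^+ j./2.
  rewrite -[in LHS](odd_double_half j) exprD -mul2n exprM.
  by rewrite [(i * y) ^+ 2]exprMn i2 mulN1r.
rewrite exprDn (bigID (fun j : 'I_k.+1 => ~~ odd j)) /=; congr (_ + _).
  by apply: eq_bigr => j /negbTE oj; rewrite aux oj expr0 mul1r.
rewrite /p1 mulr_sumr; apply: eq_big => j; first by rewrite negbK.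
by rewrite negbK => oj; rewrite aux oj expr1 mulrnAr mulrCA.
Qed.

Lemma sum_sq_factor (A : comNzRingType) (i x y : A) : i ^+ 2 = -1 ->
  x ^+ 2 + y ^+ 2 = (x + i * y) * (x + i * - y).
Proof. by move=> i2; rewrite mulrN mulrC -subr_sqr exprMn i2 mulN1r opprK. Qed.

Lemma p01_norm (A : comNzRingType) (i : A) k (x y : A) : i ^+ 2 = -1 ->
  p0 k x (y ^+ 2) ^+ 2 + p1 k x (y ^+ 2) ^+ 2 * y ^+ 2 =
  ((x + i * y) * (x + i * - y)) ^+ k.
Proof.
move=> i2; rewrite exprMn !(expr_p01 _ _ _ i2) sqrrN -exprMn.
by rewrite (sum_sq_factor _ _ i2) !mulrN !mulNr [p1 _ _ _ * y]mulrC !mulrA.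
Qed.

Lemma p0_homogeneous (A : comNzRingType) (k : nat) (c x t : A) :
  p0 k (c * x) (c ^+ 2 * t) = c ^+ k * p0 k x t.
Proof.
rewrite /p0 mulr_sumr; apply: eq_bigr => j /negbTE oj.
rewrite mulrnAr; congr (_ *+ _).
have jE : (k = k - j + 2 * j./2)%N.
  by have := odd_double_half j; have := ltn_ord j; rewrite oj; lia.
have -> : c ^+ k = c ^+ (k - j) * (c ^+ 2) ^+ j./2.
  by rewrite -exprM -exprD -jE.
by rewrite -mulrN !exprMn; ring.
Qed.

Lemma p1_homogeneous (A : comNzRingType) (k : nat) (c x t : A) :
  c * p1 k (c * x) (c ^+ 2 * t) = c ^+ k * p1 k x t.
Proof.
rewrite /p1 !mulr_sumr; apply: eq_bigr => j oj.
rewrite !mulrnAr; congr (_ *+ _).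
have jE : (k = (k - j + 2 * j./2).+1)%N.
  by have := odd_double_half j; have := ltn_ord j; rewrite oj; lia.
have -> : c ^+ k = c * (c ^+ (k - j) * (c ^+ 2) ^+ j./2).
  by rewrite -exprM -exprD -exprS -jE.
by rewrite -mulrN !exprMn; ring.
Qed.

(** Evaluation of polynomials is a ring morphism; with these lemmas, [p0] and
    [p1] of polynomials can be evaluated pointwise. *)
Lemma rmorph_p0 (A B : comNzRingType) (f : {rmorphism A -> B}) k x t :
  f (p0 k x t) = p0 k (f x) (f t).
Proof.
rewrite /p0 rmorph_sum; apply: eq_bigr => j _.
by rewrite rmorphMn rmorphM !rmorphXn rmorphN.
Qed.

Lemma rmorph_p1 (A B : comNzRingType) (f : {rmorphism A -> B}) k x t :
  f (p1 k x t) = p1 k (f x) (f t).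
Proof.
rewrite /p1 rmorph_sum; apply: eq_bigr => j _.
by rewrite rmorphMn rmorphM !rmorphXn rmorphN.
Qed.

(** * Roots of unity *)

Lemma unity_root_neq0 (F : fieldType) (c : F) k :
  (0 < k)%N -> c ^+ k = 1 -> c != 0.
Proof.
move=> k0; apply: contra_eq_neq => ->.
by rewrite expr0n gtn_eqF // eq_sym oner_neq0.
Qed.

(** The polynomial [X^n - 1] splits, and it is separable in characteristic 0, so
    that its [n] roots are distinct and form a cyclic group of order [n]. *)
Lemma exists_prim_root (F : numClosedFieldType) n : (0 < n)%N ->
  exists z : F, n.-primitive_root z.
Proof.
move=> n_gt0; have [r Dp] := closed_field_poly_normal ('X^n - 1 : {poly F}).
rewrite (monicP _) ?monicXnsubC // scale1r in Dp.
have rn1 : all n.-unity_root r.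
  by apply/allP => z; rewrite -root_prod_XsubC -Dp.
have sr : (n < (size r).+1)%N.
  by rewrite -(size_prod_XsubC r id) -Dp size_XnsubC.
have [|z] := hasP (has_prim_root n_gt0 rn1 _ sr); last by exists z.
by rewrite -separable_prod_XsubC -Dp separable_Xn_sub_1 // pnatr_eq0 -lt0n.
Qed.

(** * The two domains as complements of hypersurfaces *)

(** In terms of [x = z_0] and [t = vsq z_], the product of all the polynomials
    that must not vanish on the domain; the second factor, present when [b] holds,
    pulls back the conditions that define [Omega]. The base ring is arbitrary
    because the form is also evaluated at polynomials in a curve parameter. *)
Definition excluded (A : comNzRingType) (b : bool) (k : nat) (x t : A) : A :=
  t * (x ^+ 2 + t) * x * p1 k x t *
  (p1 k x t ^+ 2 * t * (p0 k x t ^+ 2 + p1 k x t ^+ 2 * t) * p0 k x t) ^+ b.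

Lemma rmorph_excluded (A B : comNzRingType) (f : {rmorphism A -> B}) b k x t :
  f (excluded b k x t) = excluded b k (f x) (f t).
Proof.
by rewrite /excluded !(rmorphM, rmorphXn, rmorphD) /= !(rmorph_p0, rmorph_p1).
Qed.

Section Space.
Context {R : realType}.
Implicit Types (k : nat) (z : C4 R) (v w : 'rV[R[i]]_3).

(** The bilinear form that polarizes [vsq]. *)
Definition dot v w : R[i] := \sum_(i < 3) v 0 i * w 0 i.

Lemma dotZl c v w : dot (c *: v) w = c * dot v w.
Proof. by rewrite /dot mulr_sumr; apply: eq_bigr => i _; rewrite mxE mulrA. Qed.

Lemma dot_vsq v : dot v v = vsq v.
Proof. by apply: eq_bigr => i _; rewrite expr2. Qed.

Lemma vsqZ c v : vsq (c *: v) = c ^+ 2 * vsq v.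
Proof. by rewrite /vsq mulr_sumr; apply: eq_bigr => i _; rewrite mxE exprMn. Qed.

Definition cover_dom (b : bool) k : set (C4 R) :=
  [set z | excluded b k z.1 (vsq z.2) != 0].

Lemma Omega_kE k : Omega_k k = cover_dom false k.
Proof.
apply/seteqP; split=> z;
  rewrite /cover_dom /Omega_k /Omega /excluded /= expr0 mulr1.
  by move=> [[t0 s0 x0] p0]; rewrite !mulf_neq0.
by rewrite !mulf_eq0 !negb_or => /andP[/andP[/andP[-> ->] ->] ->].
Qed.

Lemma Omega_k_overE k : Omega_k_over k = cover_dom true k.
Proof.
apply/seteqP; split=> z; rewrite /Omega_k_over Omega_kE.
  rewrite /cover_dom /excluded /Omega /= expr1 expr0 mulr1 vsqZ.
  by move=> [zE [t0 s0 x0]]; rewrite mulf_neq0 // (mulf_neq0 (mulf_neq0 _ _)).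
rewrite /cover_dom /excluded /Omega /= expr0 mulr1 vsqZ.
set E := _ * p1 k _ _; rewrite !mulf_eq0 !negb_or.
by move=> /andP[-> /andP[/andP[/andP[-> ->] ->] ->]].
Qed.

(** Scalar multiplication by a [k]-th root of unity preserves the fibres: this is
    where the deck transformations come from. *)
Lemma sigma_scale k (c : R[i]) z : sigma k (c *: z) = c ^+ k *: sigma k z.
Proof.
case: z => x v; rewrite /sigma /= vsqZ p0_homogeneous; congr pair.
by rewrite !scalerA mulrC p1_homogeneous.
Qed.

Lemma excluded_scale b k (c x t : R[i]) : c ^+ k = 1 -> (0 < k)%N ->
  excluded b k x t != 0 -> excluded b k (c * x) (c ^+ 2 * t) != 0.
Proof.
move=> ck k0; have c0 := unity_root_neq0 k0 ck.
have -> : excluded b k (c * x) (c ^+ 2 * t) =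
    c ^+ 2 * c ^+ 2 * excluded b k x t.
  rewrite /excluded p0_homogeneous ck mul1r.
  have -> : p1 k (c * x) (c ^+ 2 * t) = c^-1 * p1 k x t.
    by apply: (mulfI c0); rewrite p1_homogeneous ck mul1r mulVKf.
  by case: b; rewrite ?expr0 ?expr1; field.
by move=> e0; rewrite mulf_neq0 // mulf_neq0 // expf_neq0.
Qed.

Lemma cover_dom_scale b k c z : c ^+ k = 1 -> (0 < k)%N ->
  cover_dom b k z -> cover_dom b k (c *: z).
Proof.
by move=> ck k0 zE; rewrite /cover_dom /= vsqZ; exact: excluded_scale.
Qed.

End Space.

Section ImaginaryUnit.
Context {R : realType}.

Lemma sqrI : ('i%C : R[i]) ^+ 2 = -1. Proof. exact: sqr_i. Qed.

Lemma I_neq0 : ('i%C : R[i]) != 0.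
Proof.
by apply: contra_eq_neq sqrI => ->; rewrite expr0n eq_sym oppr_eq0 oner_neq0.
Qed.

End ImaginaryUnit.

(** * Curves that avoid the zeros of a polynomial *)

Section Curves.
Context {R : realType}.

(** The parabola [t + i h t (1 - t)]. For different [h], these curves from 0 to 1
    meet at 0 and 1 only. *)
Definition arc (h : nat) (t : R) : R[i] :=
  t%:C%C + 'i%C * h%:R * (t * (1 - t))%:C%C.

Lemma arc0 h : arc h 0 = 0.
Proof. by rewrite /arc mul0r rmorph0 mulr0 addr0. Qed.

Lemma arc1 h : arc h 1 = 1.
Proof. by rewrite /arc subrr mulr0 rmorph0 mulr0 addr0 rmorph1. Qed.

Lemma arcE h t : arc h t = (t +i* (h%:R * (t * (1 - t))))%C.
Proof.
rewrite /arc -(rmorph_nat (@real_complex R)).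
rewrite -mulrA -rmorphM /=; apply/eqP; rewrite eq_complex /=.
by apply/andP; split; apply/eqP; ring.
Qed.

(** If each arc met a root, these roots would be distinct, because the common
    ends of the arcs are no roots; as many arcs as [size F] already give more
    roots than the degree allows. *)
Lemma arc_avoids (F : {poly R[i]}) : F.[0] != 0 -> F.[1] != 0 ->
  exists h, forall t, F.[arc h t] != 0.
Proof.
move=> F0 F1; apply: contrapT => /forallNP noh.
have ex h : exists t, root F (arc h t).
  have /existsNP[t /negP] := noh h; rewrite negbK => Ft.
  by exists t; apply/eqP/eqP.
have [t tP] := choice ex.
pose s := [seq arc h (t h) | h <- iota 0 (size F)].
have Fn0 : F != 0 by apply: contra_neq F0 => ->; rewrite horner0.
have sF : all (root F) s by apply/allP => _ /mapP[h _ ->].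
have su : uniq s.
  rewrite map_inj_uniq ?iota_uniq // => h h'; rewrite !arcE => -[tt].
  have := tP h; rewrite arcE -tt => rt.
  have [t0|t0] := eqVneq (t h) 0.
    by move: rt; rewrite t0 mul0r mulr0 rootE (negbTE F0).
  have [t1|t1] := eqVneq (t h) 1.
    by move: rt; rewrite t1 subrr !mulr0 rootE (negbTE F1).
  move/(mulIf _) => /(_ _)/eqP; rewrite eqr_nat => /(_ _)/eqP; apply.
  by rewrite mulf_neq0 // subr_eq0 eq_sym.
by have := max_poly_roots Fn0 sF su; rewrite size_map size_iota ltnn.
Qed.

Lemma continuous_real_complex : continuous (fun t : R => t%:C%C : R[i]).
Proof.
move=> t; apply/cvgrPdist_lt => e e0.
have eE : e = (complex.Re e)%:C%C by rewrite RRe_real // gtr0_real.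
have e1 : 0 < complex.Re e by move: e0; rewrite eE ltcR.
near=> u.
rewrite -rmorphB normc_def /= expr0n addr0 sqrtr_sqr eE ltcR.
near: u; exact: cvgr_dist_lt.
Unshelve. all: by end_near. Qed.

Lemma continuous_expr (T : topologicalType) (g : T -> R[i]) n :
  continuous g -> continuous (fun t => g t ^+ n).
Proof.
move=> cg; elim: n => [|n IH].
  by under eq_fun do rewrite expr0; move=> t; exact: cvg_cst.
by under eq_fun do rewrite exprS; move=> t; apply: cvgM; [exact: cg|exact: IH].
Qed.

Lemma continuous_bigsum (T : topologicalType) n (g : 'I_n -> T -> R[i]) :
  (forall i, continuous (g i)) -> continuous (fun t => \sum_(i < n) g i t).
Proof.
elim: n g => [|n IH] g cg.
  by under eq_fun do rewrite big_ord0; move=> t; exact: cvg_cst.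
under eq_fun do rewrite big_ord_recl.
move=> t; apply: cvgD; first exact: cg.
exact: (IH (fun i => g (lift ord0 i))).
Qed.

Lemma continuous_arc h : continuous (arc h).
Proof.
move=> t; apply: cvgD; first exact: continuous_real_complex.
apply: cvgM; first exact: cvg_cst.
apply: (cvg_comp (fun t => t * (1 - t)) (fun t => t%:C%C)); last first.
  exact: continuous_real_complex.
apply: cvgM; first exact: cvg_id.
by apply: cvgB; [exact: cvg_cst|exact: cvg_id].
Qed.

(** The factorization [g1^k - g2^k = (g1 - g2) S] makes the coincidence set of
    [g1] and [g2] clopen: it is closed as the zero set of [g1 - g2], and it is the
    set where [S] does not vanish, since on it [S = k g2^(k-1)]. *)
Lemma eq_fun_of_eq_expr (k : nat) (g1 g2 : R -> R[i]) : (0 < k)%N ->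
  continuous g1 -> continuous g2 ->
  (forall t, g1 t ^+ k = g2 t ^+ k) -> (forall t, g2 t != 0) ->
  g1 0 = g2 0 -> g1 =1 g2.
Proof.
move=> k0 c1 c2 g12 g20 g00 t.
pose S t := \sum_(i < k) g1 t ^+ (k.-1 - i) * g2 t ^+ i.
have cS : continuous S.
  apply: continuous_bigsum => i u.
  have cX1 := @continuous_expr _ g1 (k.-1 - i) c1.
  have cX2 := @continuous_expr _ g2 i c2.
  exact: cvgM (cX1 u) (cX2 u).
have cB : continuous (fun t => g1 t - g2 t).
  by move=> u; apply: cvgB; [exact: c1|exact: c2].
have SE u : (g1 u = g2 u) <-> S u != 0.
  split=> [gu|S0].
    rewrite /S gu (eq_bigr (fun=> g2 u ^+ k.-1)) => [|i _]; last first.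
      by rewrite -exprD subnK // -ltnS prednK.
    by rewrite sumr_const card_ord mulrn_eq0 negb_or -lt0n k0 expf_neq0.
  apply/eqP; rewrite -subr_eq0 -(inj_eq (mulIf S0)) mul0r.
  by rewrite -subrXX g12 subrr.
pose B := [set u | g1 u = g2 u].
suff : B = setT by move=> BT; have : setT t by []; rewrite -BT.
have cl0 : closed [set (0 : R[i])].
  by apply: accessible_closed_set1; apply: hausdorff_accessible.
have cT : connected [set: R] by apply/connected_intervalP.
apply: cT; first by exists 0.
- exists B; rewrite ?setTI //.
  have -> : B = S @^-1` (~` [set 0]).
    by apply/seteqP; split=> u /= => [/SE/eqP|/eqP/SE].
  by apply: open_comp => [u _|]; [exact: cS|exact: closed_openC].
- exists B; rewrite ?setTI //.
  have -> : B = (fun t => g1 t - g2 t) @^-1` [set 0].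
    by apply/seteqP; split=> u /=; [move=> ->; rewrite subrr|exact: subr0_eq].
  exact: (continuous_closedP _).1 cB _ cl0.
Qed.

End Curves.

(** * A parametrization of the cone vsq v = y^2 *)

Section Cone.
Context {R : realType}.
Local Notation I := ('i%C : R[i]).

(** In the coordinates [m = v_0 + i v_1], [n = v_0 - i v_1], the equation
    [vsq v = y^2] reads [m n = (y - v_2) (y + v_2)], which says that a 2x2 matrix
    has rank at most one. Such a matrix is an outer product of [(a, b)] and
    [(c, d)]; the vector and the chosen square root of its [vsq] are thus
    quadratic in four free parameters. *)
Definition cone_sqrt (A : comNzRingType) (a b c d : A) : A := a * c + b * d.

Definition cone_vec (a b c d : R[i]) : 'rV[R[i]]_3 :=
  \row_j [:: a * d + b * c; - I * (a * d - b * c); b * d - a * c]`_j.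

Lemma ord3_cases (j : 'I_3) : j = 0 \/ j = 1 \/ j = 2%:R.
Proof.
by case: j => [[|[|[|//]]] h]; [left|right; left|right; right]; apply: val_inj.
Qed.

Lemma vsqE (v : 'rV[R[i]]_3) : vsq v = v 0 0 ^+ 2 + v 0 1 ^+ 2 + v 0 2%:R ^+ 2.
Proof.
rewrite /vsq !big_ord_recl big_ord0 addr0 addrA.
by congr (_ + v 0 _ ^+ 2 + v 0 _ ^+ 2); apply: val_inj.
Qed.

Lemma cone_vsq a b c d : vsq (cone_vec a b c d) = cone_sqrt a b c d ^+ 2.
Proof.
by rewrite vsqE !mxE /= exprMn sqrrN sqrI /cone_sqrt; ring.
Qed.

Lemma rank_one_factor (F : fieldType) (p q m n : F) :
  m * n = p * q -> (p != 0) || (q != 0) ->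
  exists a b c d, [/\ p = a * c, q = b * d, m = a * d & n = b * c].
Proof.
move=> mn; have [p0 /= q0|p0 _] := eqVneq p 0.
  exists (m / q), 1, n, q; rewrite !mul1r divfK //; split=> //.
  by rewrite mulrAC mn mulfK.
exists 1, (n / p), p, m; rewrite !mul1r divfK //; split=> //.
by rewrite mulrAC [n * m]mulrC mn mulrC mulKf.
Qed.

Lemma cone_param_onto (v : 'rV[R[i]]_3) (y : R[i]) : vsq v = y ^+ 2 -> y != 0 ->
  exists a b c d, y = cone_sqrt a b c d /\ v = cone_vec a b c d.
Proof.
rewrite vsqE => vy y0; have two : 2%:R != 0 :> R[i] by rewrite pnatr_eq0.
have i2 : I ^+ 2 = -1 by exact: sqrI.
pose p := (y - v 0 2%:R) / 2%:R; pose q := (y + v 0 2%:R) / 2%:R.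
pose m := (v 0 0 + I * v 0 1) / 2%:R; pose n := (v 0 0 - I * v 0 1) / 2%:R.
have pqE : y = p + q by rewrite /p /q; field.
have [||a [b [c [d [pE qE mE nE]]]]] := @rank_one_factor _ p q m n.
- have -> : m * n = (v 0 0 ^+ 2 - I ^+ 2 * v 0 1 ^+ 2) / 4%:R.
    by rewrite /m /n; field.
  have -> : p * q = (y ^+ 2 - v 0 2%:R ^+ 2) / 4%:R by rewrite /p /q; field.
  by rewrite i2 -vy; congr (_ / _); ring.
- by rewrite -negb_and; apply: contra y0 => /andP[/eqP p0 /eqP q0];
    rewrite pqE p0 q0 addr0.
exists a, b, c, d; rewrite /cone_sqrt -pE -qE; split=> //.
apply/rowP => j; rewrite mxE -pE -qE -mE -nE.
have [->|[->|->]] := ord3_cases j.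
- by rewrite /= /m /n; field.
- have -> : - I * (m - n) = - I ^+ 2 * v 0 1 by rewrite /m /n; field.
  by rewrite i2 opprK mul1r.
- by rewrite /= /p /q; field.
Qed.

Lemma continuous_row (T : topologicalType) n (g : T -> 'rV[R[i]]_n) :
  (forall j, continuous (fun t => g t 0 j)) -> continuous g.
Proof.
move=> cg t B [P nP PB].
rewrite nbhs_filterE /=.
have : \forall u \near t, forall i j, P i j (g u i j).
  apply: filter_forall => i; apply: filter_forall => j; rewrite ord1.
  exact: cg (nP _ _).
by apply: filterS => u Pu; apply: PB.
Qed.

End Cone.

(** * Connectedness of the lifted domain *)

Section Main.
Context {R : realType}.
Local Notation I := ('i%C : R[i]).

Definition lin (A : comNzRingType) (x y s : A) : A := x + s * (y - x).

Lemma continuous_lin (x y : R[i]) (s : R -> R[i]) : continuous s ->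
  continuous (fun t => lin x y (s t) : R[i]).
Proof.
move=> cs t; apply: cvgD; first exact: cvg_cst.
by apply: cvgM; [exact: cs|exact: cvg_cst].
Qed.

Lemma lin0 (A : comNzRingType) (x y : A) : lin x y 0 = x.
Proof. by rewrite /lin mul0r addr0. Qed.

Lemma lin1 (A : comNzRingType) (x y : A) : lin x y 1 = y.
Proof. by rewrite /lin mul1r addrC subrK. Qed.

Lemma horner_lin (x y s : R[i]) : (lin x%:P y%:P 'X).[s] = lin x y s.
Proof. by rewrite /lin !hornerE. Qed.

Lemma continuous_cone_vec (a b c d : R -> R[i]) :
  continuous a -> continuous b -> continuous c -> continuous d ->
  continuous (fun t => cone_vec (a t) (b t) (c t) (d t)).
Proof.
move=> ca cb cc cd; apply: continuous_row => j.
under eq_fun do rewrite mxE.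
have [->|[->|->]] := ord3_cases j.
- change (continuous (fun t => a t * d t + b t * c t)) => t.
  by apply: cvgD; apply: cvgM; [exact: ca|exact: cd|exact: cb|exact: cc].
- change (continuous (fun t => - I * (a t * d t - b t * c t))) => t.
  apply: cvgM; first exact: cvg_cst.
  by apply: cvgB; apply: cvgM; [exact: ca|exact: cd|exact: cb|exact: cc].
- change (continuous (fun t => b t * d t - a t * c t)) => t.
  by apply: cvgB; apply: cvgM; [exact: cb|exact: cd|exact: ca|exact: cc].
Qed.

(** The space of pairs [(z, y)], with [z] in the domain and [y] a square root of
    [vsq z_], is connected. The pairs are described by five free parameters,
    [z_0] and the four of the cone; along the complex line through two parameter
    points the excluded locus is the zero set of a polynomial, and an arc of that
    line avoids it. *)
Lemma lifted_path b k (z z' : C4 R) (y y' : R[i]) :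
  cover_dom b k z -> cover_dom b k z' ->
  vsq z.2 = y ^+ 2 -> vsq z'.2 = y' ^+ 2 ->
  exists (g : R -> C4 R) (e : R -> R[i]),
  [/\ continuous g, continuous e, g 0 = z /\ e 0 = y, g 1 = z' /\ e 1 = y' &
      forall t, cover_dom b k (g t) /\ vsq (g t).2 = e t ^+ 2].
Proof.
case: z z' => x v [x' v']; rewrite /cover_dom /= => zE z'E vy vy'.
have y0 : y != 0.
  by apply: contraNneq zE => y0; rewrite vy y0 /excluded expr0n /= !mul0r.
have y0' : y' != 0.
  by apply: contraNneq z'E => y0'; rewrite vy' y0' /excluded expr0n /= !mul0r.
have [a1 [a2 [a3 [a4 [yE vE]]]]] := cone_param_onto vy y0.
have [b1 [b2 [b3 [b4 [yE' vE']]]]] := cone_param_onto vy' y0'.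
pose F : {poly R[i]} := excluded b k (lin x%:P x'%:P 'X)
  (cone_sqrt (lin a1%:P b1%:P 'X) (lin a2%:P b2%:P 'X)
             (lin a3%:P b3%:P 'X) (lin a4%:P b4%:P 'X) ^+ 2).
pose E (s : R[i]) :=
  cone_sqrt (lin a1 b1 s) (lin a2 b2 s) (lin a3 b3 s) (lin a4 b4 s).
have FE s : F.[s] = excluded b k (lin x x' s) (E s ^+ 2).
  have /= := rmorph_excluded (horner_eval s) b k.
  rewrite /horner_eval => ->; rewrite horner_lin; congr excluded.
  by rewrite horner_exp /cone_sqrt hornerD !hornerM !horner_lin.
have F0 : F.[0] != 0.
  by rewrite FE /E !lin0 -yE -vy; exact: zE.
have F1 : F.[1] != 0.
  by rewrite FE /E !lin1 -yE' -vy'; exact: z'E.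
have [h hF] := arc_avoids F0 F1.
pose w s := cone_vec (lin a1 b1 s) (lin a2 b2 s) (lin a3 b3 s) (lin a4 b4 s).
have cl (u u' : R[i]) : continuous (fun t => lin u u' (arc h t) : R[i]).
  by apply: continuous_lin; exact: continuous_arc.
exists (fun t => (lin x x' (arc h t), w (arc h t))), (fun t => E (arc h t)).
split.
- have cw : continuous (fun t => w (arc h t)) by exact: continuous_cone_vec.
  by move=> t; exact: cvg_pair (cl x x' t) (cw t).
- by move=> t; apply: cvgD; apply: cvgM; exact: cl.
- by rewrite arc0 /w /E !lin0 -yE -vE.
- by rewrite arc1 /w /E !lin1 -yE' -vE'.
- by move=> t /=; rewrite cone_vsq -FE.
Qed.

(** * Maps that preserve the fibres are scalar *)

(** If [w_ = c z_] and [y^2 = vsq z_], this is [y (w_0 + i c y)], in which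
    [w_0 + i c y] is a coordinate of the lift [(w, c y)] of [w]. The factor [y]
    clears the denominator that [c] would bring in. *)
Definition lift_pairing (z w : C4 R) y := y * w.1 + I * dot w.2 z.2.

(** In the coordinate [z_0 + i y] of the lifts, [sigma k] is the [k]-th power. *)
Lemma lift_pairing_expr k (z w : C4 R) y : p1 k w.1 (vsq w.2) != 0 ->
  sigma k w = sigma k z -> vsq z.2 = y ^+ 2 ->
  lift_pairing z w y ^+ k = (y * (z.1 + I * y)) ^+ k.
Proof.
case: z w => x v [x' v']; rewrite /lift_pairing /sigma /= => p1w [] e0 e1 vy.
pose c := p1 k x (vsq v) / p1 k x' (vsq v').
have v'E : v' = c *: v.
  by apply: (scalerI p1w); rewrite scalerA e1 mulrC divfK.
have -> : y * x' + I * dot v' v = y * (x' + I * (c * y)).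
  by rewrite v'E dotZl dot_vsq vy; ring.
rewrite !exprMn; congr (_ * _).
have vy' : (c * y) ^+ 2 = vsq v' by rewrite v'E vsqZ vy exprMn.
have cp : c * p1 k x' (vsq v') = p1 k x (vsq v) by rewrite divfK.
rewrite (expr_p01 k x' (c * y) sqrI) (expr_p01 k x y sqrI) vy' -vy e0 -cp.
by congr (_ + _); rewrite [c * y]mulrC -!mulrA.
Qed.

Lemma continuous_C4_fst (h : R -> C4 R) : continuous h ->
  continuous (fun t => (h t).1).
Proof. by move=> ch t; exact: cvg_comp (ch t) cvg_fst. Qed.

Lemma continuous_C4_snd (h : R -> C4 R) j : continuous h ->
  continuous (fun t => (h t).2 0 j).
Proof.
move=> ch; have cs : continuous (fun t => (h t).2).
  by move=> t; exact: cvg_comp (ch t) cvg_snd.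
by move=> t; exact: cvg_comp (cs t) (@coord_continuous _ _ _ 0 j ((h t).2)).
Qed.

Lemma cover_dom_lift_neq0 b k (z : C4 R) (y : R[i]) :
  cover_dom b k z -> vsq z.2 = y ^+ 2 ->
  y != 0 /\ z.1 + I * y != 0.
Proof.
rewrite /cover_dom => zE zy; split; apply: contraNneq zE => e0.
  by rewrite zy e0 /excluded expr0n !mul0r.
have -> : excluded b k z.1 (vsq z.2) = 0; last by [].
rewrite /excluded zy; have -> : z.1 ^+ 2 + y ^+ 2 = 0.
  by rewrite (sum_sq_factor _ _ sqrI) e0 mul0r.
by rewrite !(mulr0, mul0r).
Qed.

Lemma cover_dom_p1 b k (z : C4 R) :
  cover_dom b k z -> p1 k z.1 (vsq z.2) != 0.
Proof.
rewrite /cover_dom => zE; apply: contraNneq zE => p1z.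
by rewrite /excluded p1z mulr0 mul0r.
Qed.

(** The ratio of the two sides is a continuous function on a connected space with
    values in the [k]-th roots of unity. *)
Lemma lift_pairing_ratio_constant b k (f : cover_dom b k -> cover_dom b k)
    (x x' : cover_dom b k) (y y' c : R[i]) : (0 < k)%N ->
  continuous f -> (forall x, sigma k (val (f x)) = sigma k (val x)) ->
  vsq (val x).2 = y ^+ 2 -> vsq (val x').2 = y' ^+ 2 -> c ^+ k = 1 ->
  lift_pairing (val x) (val (f x)) y = c * (y * ((val x).1 + I * y)) ->
  lift_pairing (val x') (val (f x')) y' = c * (y' * ((val x').1 + I * y')).
Proof.
move=> k0 cf sf xy xy' ck.
have sx : cover_dom b k (val x) := set_valP x.
have sx' : cover_dom b k (val x') := set_valP x'.
have [g [e [cg ce [g0 e0] [g1 e1] gP]]] := lifted_path sx sx' xy xy'.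
pose G t : cover_dom b k := exist _ (g t) (mem_set (gP t).1).
have cG : continuous G by apply: continuous_comp_initial; exact: cg.
have cfG : continuous (fun t => val (f (G t))).
  have cv : continuous (fun u : cover_dom b k => val u : C4 R).
    exact: initial_continuous.
  by move=> t; exact: cvg_comp (cvg_comp _ _ (cG t) (cf (G t))) (cv (f (G t))).
have G0 : G 0 = x by apply: val_inj.
have G1 : G 1 = x' by apply: val_inj.
rewrite -G0 -G1 -e0 -e1.
pose l t := lift_pairing (g t) (val (f (G t))) (e t).
pose r t := c * (e t * ((g t).1 + I * e t)).
move=> h0; apply: (@eq_fun_of_eq_expr R k l r k0).
- move=> t; apply: cvgD.
    by apply: cvgM; [exact: ce|exact: continuous_C4_fst].
  apply: cvgM; first exact: cvg_cst.
  apply: continuous_bigsum => j u.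
  by apply: cvgM; exact: continuous_C4_snd.
- move=> t; apply: cvgM; first exact: cvg_cst.
  apply: cvgM; first exact: ce.
  apply: cvgD; first exact: continuous_C4_fst.
  by apply: cvgM; [exact: cvg_cst|exact: ce].
- move=> t; rewrite /l /r exprMn ck mul1r.
  exact: lift_pairing_expr (cover_dom_p1 (set_valP _)) (sf (G t)) (gP t).2.
- move=> t; have [y0 ny0] := cover_dom_lift_neq0 (gP t).1 (gP t).2.
  by rewrite /r !mulf_neq0 // (unity_root_neq0 k0 ck).
- exact: h0.
Qed.

(** The ratio [c] is the same at the two lifts [(z, y)] and [(z, - y)] of a point.
    The difference of the two equations gives the first coordinate of the image,
    and their sum gives the factor of the vector part. *)
Lemma deck_scalar b k (f : @cover_dom R b k -> @cover_dom R b k) :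
  (0 < k)%N -> continuous f ->
  (forall x, sigma k (val (f x)) = sigma k (val x)) ->
  exists c, c ^+ k = 1 /\ forall x, val (f x) = c *: val x.
Proof.
move=> k0 cf sf.
have [[x0 _]|nox] := pselect (exists x : @cover_dom R b k, True); last first.
  exists 1; split=> [|x]; first exact: expr1n.
  by exfalso; apply: nox; exists x.
pose y0 := sqrtC (vsq (val x0).2).
have xy0 : vsq (val x0).2 = y0 ^+ 2 by rewrite sqrtCK.
pose d0 := y0 * ((val x0).1 + I * y0).
have d00 : d0 != 0.
  by have [? ?] := cover_dom_lift_neq0 (set_valP x0) xy0; rewrite mulf_neq0.
pose c := lift_pairing (val x0) (val (f x0)) y0 / d0.
have ck : c ^+ k = 1.
  have p1fx0 := cover_dom_p1 (set_valP (f x0)).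
  rewrite exprMn exprVn (lift_pairing_expr p1fx0 (sf x0) xy0).
  by rewrite divff ?expf_neq0.
exists c; split=> // x.
have c0 : lift_pairing (val x0) (val (f x0)) y0 = c * d0 by rewrite divfK.
pose y := sqrtC (vsq (val x).2).
have xy : vsq (val x).2 = y ^+ 2 by rewrite sqrtCK.
have xy' : vsq (val x).2 = (- y) ^+ 2 by rewrite sqrrN.
(* The two lifts of x, which differ in the sign of y. *)
have := lift_pairing_ratio_constant k0 cf sf xy0 xy ck c0.
have := lift_pairing_ratio_constant k0 cf sf xy0 xy' ck c0.
have [y1 _] := cover_dom_lift_neq0 (set_valP x) xy.
have sfx := sf x.
have p1fx := cover_dom_p1 (set_valP (f x)).
move: xy p1fx sfx; rewrite /sigma /lift_pairing.
move: (val x) (val (f x)) => [z v] [z' v'] /= xy p1z' [] _.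
move/(congr1 (fun u => (p1 k z' (vsq v'))^-1 *: u)).
rewrite !scalerA mulVf // scale1r => v'E.
set a := _ * p1 _ _ _ in v'E.
rewrite v'E dotZl dot_vsq xy => e1 e2.
have two : 2%:R != 0 :> R[i] by rewrite pnatr_eq0.
have zE : z' = c * z.
  apply: (mulfI (mulf_neq0 two y1)).
  transitivity (y * z' + I * (a * y ^+ 2) -
    (- y * z' + I * (a * y ^+ 2))); first by ring.
  by rewrite e1 e2; ring.
have -> : a = c; last by rewrite zE.
have I0 : I != 0 := I_neq0.
apply: (mulfI (mulf_neq0 (mulf_neq0 two I0) (mulf_neq0 y1 y1))).
transitivity (y * z' + I * (a * y ^+ 2) +
    (- y * z' + I * (a * y ^+ 2))); first by ring.
by rewrite e1 e2; ring.
Qed.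
End Main.

(** * Points of one fibre *)

Section Final.
Context {R : realType}.
Local Notation I := ('i%C : R[i]).

(** With [y = - i (2 w - 1)], the coordinates [z_0 + i y] and [z_0 - i y] are
    [4 w] and [2]; their [k]-th powers are the same for all [k]-th roots of
    unity [w], which places all these points in one fibre. *)
Definition fibre_pt (w : R[i]) : C4 R :=
  (2%:R * w + 1, \row_j (if j == 0 then - I * (2%:R * w - 1) else 0)).

Lemma fibre_pt_vsq w : vsq (fibre_pt w).2 = (- I * (2%:R * w - 1)) ^+ 2.
Proof. by rewrite vsqE !mxE /= expr0n !addr0. Qed.

Lemma fibre_pt_coords w :
  [/\ (fibre_pt w).1 + I * (- I * (2%:R * w - 1)) = 4%:R * w &
      (fibre_pt w).1 + I * - (- I * (2%:R * w - 1)) = 2%:R].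
Proof.
have I2 : I * I = -1 by rewrite -expr2 sqrI.
split.
  by rewrite mulrA mulrN I2 opprK mul1r /=; ring.
by rewrite !mulNr opprK mulrA I2 mulN1r /=; ring.
Qed.

Section Fibre.
Context (k : nat) (w : R[i]) (k0 : (0 < k)%N) (wk : w ^+ k = 1).
Let x := (fibre_pt w).1.
Let y := - I * (2%:R * w - 1).

Lemma fibre_pt_p01 : p0 k x (y ^+ 2) = (4%:R ^+ k + 2%:R ^+ k) / 2%:R /\
  y * p1 k x (y ^+ 2) = (4%:R ^+ k - 2%:R ^+ k) / (2%:R * I).
Proof.
have [h1 h2] := fibre_pt_coords w.
have two : 2%:R != 0 :> R[i] by rewrite pnatr_eq0.
have I0 : I != 0 := I_neq0.
have e1 := expr_p01 k x y (@sqrI R).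
have e2 := expr_p01 k x (- y) (@sqrI R).
rewrite /x /y h1 exprMn wk mulr1 in e1.
rewrite /x /y h2 sqrrN in e2.
by rewrite /x /y e1 e2; split; field.
Qed.

Lemma fibre_pt_cover_dom b : cover_dom b k (fibre_pt w).
Proof.
have [p0E p1E] := fibre_pt_p01; have [h1 h2] := fibre_pt_coords w.
have two : 2%:R != 0 :> R[i] by rewrite pnatr_eq0.
have w0 := unity_root_neq0 k0 wk.
have I0 : I != 0 := I_neq0.
(* Otherwise 4^k = 1. With e = 1 and e = -1 this gives y != 0 and x != 0. *)
have w2 e : e ^+ 2 = 1 -> 2%:R * w != e.
  move=> e1; apply/eqP => we.
  have : ((2%:R * w) ^+ 2) ^+ k = 1 by rewrite we e1 expr1n.
  rewrite !exprMn wk !mulr1 -!natrX -natrM => /eqP.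
  by rewrite pnatr_eq1 -expnD -(expn0 2) eqn_exp2l // addn_eq0 gtn_eqF.
have x0 : x != 0.
  by rewrite /x /fibre_pt /= -[X in _ + X]opprK subr_eq0 w2 // sqrrN expr1n.
have y0 : y != 0 by rewrite mulf_neq0 ?oppr_eq0 // subr_eq0 w2 // expr1n.
have p00 : p0 k x (y ^+ 2) != 0.
  by rewrite p0E mulf_neq0 ?invr_eq0 // -!natrX -natrD pnatr_eq0 addn_eq0
     negb_and expn_eq0.
have yp0 : y * p1 k x (y ^+ 2) != 0.
  rewrite p1E mulf_neq0 ?invr_eq0 ?mulf_neq0 // subr_eq0 -!natrX eqr_nat.
  by rewrite eqn_exp2r.
have p10 : p1 k x (y ^+ 2) != 0 by apply: contraNneq yp0 => ->; rewrite mulr0.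
have s0 : x ^+ 2 + y ^+ 2 != 0.
  by rewrite (sum_sq_factor x y (@sqrI R)) h1 h2 !mulf_neq0 // pnatr_eq0.
have s1 : p0 k x (y ^+ 2) ^+ 2 + p1 k x (y ^+ 2) ^+ 2 * y ^+ 2 != 0.
  rewrite (p01_norm k x y (@sqrI R)) h1 h2.
  by rewrite expf_neq0 // !mulf_neq0 // pnatr_eq0.
rewrite /cover_dom /= fibre_pt_vsq -/y -/x /excluded.
rewrite mulf_neq0 //.
  by rewrite mulf_neq0 // mulf_neq0 // mulf_neq0 // expf_neq0.
by rewrite expf_neq0 // mulf_neq0 // mulf_neq0 // mulf_neq0 // expf_neq0.
Qed.

Lemma sigma_fibre_pt : sigma k (fibre_pt w) =
  ((4%:R ^+ k + 2%:R ^+ k) / 2%:R,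
   \row_j (if j == 0 then (4%:R ^+ k - 2%:R ^+ k) / (2%:R * I) else 0)).
Proof.
have [p0E p1E] := fibre_pt_p01.
rewrite /sigma fibre_pt_vsq -/x -/y p0E; congr pair.
apply/rowP => j; rewrite !mxE; case: ifP => _; last by rewrite mulr0.
by rewrite -/y mulrC p1E.
Qed.

End Fibre.
End Final.

(** * The deck group *)

Section DeckGroup.
Context {R : realType}.
Context (b : bool) (k : nat) (k0 : (0 < k)%N).
Local Notation X := (@cover_dom R b k).
Local Notation deck := (deck_group (sigma_on k X)).

Definition scale_on c (ck : c ^+ k = 1) (x : X) : X :=
  exist _ (c *: val x) (mem_set (cover_dom_scale ck k0 (set_valP x))).

Lemma continuous_scale_on c (ck : c ^+ k = 1) : continuous (scale_on ck).
Proof.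
apply: continuous_comp_initial => x.
have cv : continuous (fun u : X => val u : C4 R) by exact: initial_continuous.
exact: cvg_comp (cv x) (@scaler_continuous _ _ c (val x)).
Qed.

Lemma is_deck_scale_on c (ck : c ^+ k = 1) :
  is_deck (sigma_on k X) (scale_on ck).
Proof.
have c0 := unity_root_neq0 k0 ck.
have cVk : c^-1 ^+ k = 1 by rewrite exprVn ck invr1.
split.
  exists (scale_on cVk); split; try exact: continuous_scale_on.
  - by move=> x; apply: val_inj; rewrite /= scalerA mulVf // scale1r.
  - by move=> x; apply: val_inj; rewrite /= scalerA mulfV // scale1r.
by apply/funext => x; rewrite /= /sigma_on /= sigma_scale ck scale1r.
Qed.

Lemma aut_fun_scalar (f : deck) :
  exists c, c ^+ k = 1 /\ forall x, val (aut_fun f x) = c *: val x.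
Proof.
have [[g [_ _ cf _]] sf] := aut_funP f.
by apply: deck_scalar => // x; exact: (congr1 (@^~ x) sf).
Qed.

Definition base_pt w (wk : w ^+ k = 1) : X :=
  exist _ (fibre_pt w) (mem_set (fibre_pt_cover_dom k0 wk b)).

Lemma deck_group_isomorphic : group_isomorphic deck (Zmodulo k).
Proof.
have [w pw] := exists_prim_root R[i] k0.
have wk : w ^+ k = 1 := prim_expr_order pw.
have wX (i : nat) : (w ^+ i) ^+ k = 1 by rewrite exprAC wk expr1n.
pose psi (i : Zmodulo k) : deck :=
  mk_aut (is_deck_scale_on (wX (i : 'I_k.-1.+1))).
have kE : k.-1.+1 = k by rewrite prednK.
have psi_inj : injective psi.
  pose x1 := base_pt (expr1n _ k).
  move=> i j /(congr1 (fun f : deck => (val (aut_fun f x1)).1)) /=.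
  have x1_neq0 : 2%:R * 1 + 1 != 0 :> R[i].
    by rewrite mulr1 -(natrD _ 2 1) pnatr_eq0.
  move/(mulIf x1_neq0)/eqP; rewrite (eq_prim_root_expr pw).
  rewrite !modn_small => [/eqP/val_inj||] //; first by rewrite -{2}kE.
  by rewrite -{2}kE.
have psi_surj f : exists i, psi i = f.
  have [c [ck fE]] := aut_fun_scalar f.
  have [i cE] := prim_rootP pw ck.
  exists (cast_ord (esym kE) i); apply: aut_inj => x; apply: val_inj => /=.
  by rewrite fE cE.
have modE m : w ^+ (m %% k.-1.+1) = w ^+ m by rewrite kE prim_expr_mod.
have [phi phiK] := choice psi_surj.
exists phi; split.
  by exists psi => // i; apply: psi_inj.
move=> f g; apply: psi_inj; rewrite phiK; apply: aut_inj => x; apply: val_inj.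
rewrite -[in LHS](phiK f) -[in LHS](phiK g) /= scalerA -exprD.
by rewrite /= modE.
Qed.

(** Comparing both coordinates of [fibre_pt w = c fibre_pt 1] forces [w = 1];
    for a primitive root [w] of order [k > 1], no deck transformation maps
    [fibre_pt 1] to [fibre_pt w]. *)
Lemma not_regular_sigma : (1 < k)%N -> ~ regular_over (sigma_on k X) Omega.
Proof.
move=> k1 reg; have [w pw] := exists_prim_root R[i] k0.
have wk : w ^+ k = 1 := prim_expr_order pw.
pose x1 := base_pt (expr1n _ k).
have [|||f fE] := reg (sigma k (fibre_pt 1)) _ x1 (base_pt wk).
- have : cover_dom true k (fibre_pt (1 : R[i])).
    by apply: fibre_pt_cover_dom; rewrite ?expr1n.
  by rewrite -Omega_k_overE => -[].
- by [].
- by rewrite /sigma_on /= !sigma_fibre_pt ?expr1n.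
have [c [_ /(_ x1)]] := aut_fun_scalar f.
rewrite fE /= => -[e1 /(congr1 (fun v : 'rV_3 => v 0 0))].
rewrite !mxE /= => e2.
have {}e1 : 2%:R * w + 1 = c * (2%:R * 1 + 1) := e1.
have I0 : - 'i%C != 0 :> R[i] by rewrite oppr_eq0 I_neq0.
have cE : 2%:R * w - 1 = c.
  by apply: (mulfI I0); rewrite e2; ring.
have four : 4%:R != 0 :> R[i] by rewrite pnatr_eq0.
have w1 : w = 1.
  apply: (mulfI four).
  move: e1; rewrite -cE => /eqP; rewrite -subr_eq0 => /eqP e1.
  by rewrite -[LHS]addr0 -[X in _ + X]e1; ring.
have := prim_order_dvd pw 1; rewrite w1 expr1 eqxx dvdn1 => /eqP.
by move: k1; case: (k) => [|[]].
Qed.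
End DeckGroup.

Theorem proposition6p5 (R : realType) (k : nat) (hk : (0 < k)%N)
    (X : set (C4 R)) (hX : X = Omega_k k \/ X = Omega_k_over k) :
  group_isomorphic (deck_group (sigma_on k X)) (Zmodulo k) /\
  ((1 < k)%N -> ~ regular_over (sigma_on k X) Omega).
Proof.
have [b ->] : exists b, X = cover_dom b k.
  case: hX => ->; first by exists false; exact: Omega_kE.
  by exists true; exact: Omega_k_overE.
by split; [exact: deck_group_isomorphic|exact: not_regular_sigma].
Qed.
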